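(* Let $\mathbb F$ be a field of characteristic different from $2$ and $3$. (1) Let $(J,T)$ be a $J$-ternary algebra over $\mathbb F$ with triple product $(x,y,z)$ on $T$. Then $T$, endowed with the triple product $xyz=(x,y,z)$, is a special $(1,1)$ Freudenthal-Kantor triple system. (2) Conversely, let $(U,xyz)$ be a special $(1,1)$ Freudenthal-Kantor triple system over $\mathbb F$. Let $J=\mathbb F 1+K(U,U)$ be the $\mathbb F$-subspace of $\mathrm{End}_{\mathbb F}(U)$ spanned by the identity map and by the operators $K(x,y)$ for $x,y\in U$. Then $J$ is a subalgebra of the special Jordan algebra $\mathrm{End}_{\mathbb F}(U)^+$ (with multiplication $f\cdot g=\frac12(fg+gf)$), and the pair $(J,U)$, endowed with the natural action of $J$ on $U$, $a\bullet x=a(x)$, and the multilinear maps $$(\cdot,\cdot,\cdot):U\times U\times U\to U,\quad (x,y,z)=xyz,\qquad \langle\cdot|\cdot\rangle:U\times U\to J,\quad \langle x|y\rangle=-K(x,y),$$ is a $J$-ternary algebra.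
   Context: Freudenthal-Kantor triple systems. Let $\epsilon,\delta\in\{1,-1\}$. An $(\epsilon,\delta)$ Freudenthal-Kantor triple system is a vector space $U$ over $\mathbb F$ with a trilinear product $(x,y,z)\mapsto xyz$ such that, with $L(x,y),K(x,y)\in\mathrm{End}_{\mathbb F}(U)$ defined by $L(x,y)z=xyz$ and $K(x,y)z=xzy-\delta\, yzx$, one has, for all $x,y,u,v\in U$, $$[L(u,v),L(x,y)]=L(L(u,v)x,y)+\epsilon L(x,L(v,u)y),$$ $$K(K(u,v)x,y)=L(y,x)K(u,v)-\epsilon K(u,v)L(x,y).$$ It is called special if $K(x,y)=\epsilon\delta L(y,x)-\epsilon L(x,y)$ for all $x,y\in U$. $J$-ternary algebras. A special unital Jordan module for a unital Jordan algebra $(J,\cdot)$ is a vector space $T$ with a bilinear map $J\times T\to T$, $(a,x)\mapsto a\bullet x$, with $1\bullet x=x$ and $(a\cdot b)\bullet x=\frac12\bigl(a\bullet(b\bullet x)+b\bullet(a\bullet x)\bigr)$. Let $(J,\cdot)$ be a unital Jordan algebra, $T$ a special unital Jordan module for $J$, $\langle\cdot|\cdot\rangle:T\times T\to J$ a skew symmetric bilinear map and $(\cdot,\cdot,\cdot):T\times T\times T\to T$ a trilinear product. The pair $(J,T)$ is a $J$-ternary algebra if for all $a\in J$ and $x,y,z,w,v\in T$: (JT1) $a\cdot\langle x|y\rangle=\frac12(\langle a\bullet x|y\rangle+\langle x|a\bullet y\rangle)$; (JT2) $a\bullet(x,y,z)=(a\bullet x,y,z)-(x,a\bullet y,z)+(x,y,a\bullet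 z)$; (JT3) $(x,y,z)=(z,y,x)-\langle x|z\rangle\bullet y$; (JT4) $(x,y,z)=(y,x,z)+\langle x|y\rangle\bullet z$; (JT5) $\langle(x,y,z)|w\rangle+\langle z|(x,y,w)\rangle=\langle x|\langle z|w\rangle\bullet y\rangle$; (JT6) $(x,y,(z,w,v))=((x,y,z),w,v)+(z,(y,x,w),v)+(z,w,(x,y,v))$. *)

(* Defs.v *)
(* Vector spaces, of arbitrary dimension, are lmodTypes over a fieldType.
   Classical axioms serve to make End(U) a choiceType and to turn membership
   in a span into a boolean. *)
From HB Require Import structures.
From mathcomp Require Import all_boot all_algebra.
From mathcomp Require Import boolp.

Set Implicit Arguments.
Unset Strict Implicit.
Unset Printing Implicit Defensive.

Import GRing.Theory.
Local Open Scope ring_scope.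

Section Endomorphisms.
Variables (F : fieldType) (U : lmodType F).

(* Linear endomorphisms of U, with composition as the ring product: U may be
   infinite dimensional, so the library's 'End(U) does not apply. *)
Definition endo : Type := {linear U -> U}.

Lemma endoP (f g : endo) : f =1 g -> f = g.
Proof.
case: f g => [f [[fD] [fS]]] [g [[gD] [gS]]] /= /funext fg.
case: g / fg gD gS => gD gS.
by rewrite (Prop_irrelevance fD gD) (Prop_irrelevance fS gS).
Qed.

HB.instance Definition _ := gen_eqMixin endo.
HB.instance Definition _ := gen_choiceMixin endo.

Local Notation lin := {linear U -> U}.
Definition endo_zero : endo := (\0 : U -> U) : lin.
Definition endo_opp (f : endo) : endo := (\- (f : lin)) : lin.
Definition endo_add (f g : endo) : endo := ((f : lin) \+ (g : lin)) : lin.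
Definition endo_scale (a : F) (f : endo) : endo := (a \*: (f : lin)) : lin.
Definition endo_one : endo := (idfun : U -> U) : lin.
Definition endo_comp (f g : endo) : endo := ((f : lin) \o (g : lin)) : lin.

Fact endo_addA : associative endo_add.
Proof. by move=> f g h; apply: endoP => x; apply: addrA. Qed.
Fact endo_addC : commutative endo_add.
Proof. by move=> f g; apply: endoP => x; apply: addrC. Qed.
Fact endo_add0 : left_id endo_zero endo_add.
Proof. by move=> f; apply: endoP => x; apply: add0r. Qed.
Fact endo_addN : left_inverse endo_zero endo_opp endo_add.
Proof. by move=> f; apply: endoP => x; apply: addNr. Qed.

HB.instance Definition _ :=
  GRing.isZmodule.Build endo endo_addA endo_addC endo_add0 endo_addN.

Fact endo_compA : associative endo_comp.
Proof. by move=> f g h; apply: endoP. Qed.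
Fact endo_comp1l : left_id endo_one endo_comp.
Proof. by move=> f; apply: endoP. Qed.
Fact endo_comp1r : right_id endo_one endo_comp.
Proof. by move=> f; apply: endoP. Qed.
Fact endo_compDl : left_distributive endo_comp +%R.
Proof. by move=> f g h; apply: endoP. Qed.
Fact endo_compDr : right_distributive endo_comp +%R.
Proof. by move=> f g h; apply: endoP => x; apply: raddfD. Qed.

HB.instance Definition _ := GRing.Zmodule_isPzRing.Build endo
  endo_compA endo_comp1l endo_comp1r endo_compDl endo_compDr.

Fact endo_scaleA a b f : endo_scale a (endo_scale b f) = endo_scale (a * b) f.
Proof. by apply: endoP => x; apply: scalerA. Qed.
Fact endo_scale1 : left_id 1 endo_scale.
Proof. by move=> f; apply: endoP => x; apply: scale1r. Qed.
Fact endo_scaleDr : right_distributive endo_scale +%R.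
Proof. by move=> a f g; apply: endoP => x; apply: scalerDr. Qed.
Fact endo_scaleDl f : {morph endo_scale^~ f : a b / a + b}.
Proof. by move=> a b; apply: endoP => x; apply: scalerDl. Qed.

HB.instance Definition _ := GRing.Zmodule_isLmodule.Build F endo
  endo_scaleA endo_scale1 endo_scaleDr endo_scaleDl.

Lemma endo0E x : (0 : endo) x = 0. Proof. by []. Qed.
Lemma endo1E x : (1 : endo) x = x. Proof. by []. Qed.
Lemma endoDE (f g : endo) x : (f + g) x = f x + g x. Proof. by []. Qed.
Lemma endoNE (f : endo) x : (- f) x = - f x. Proof. by []. Qed.
Lemma endoME (f g : endo) x : (f * g) x = f (g x). Proof. by []. Qed.
Lemma endoZE a (f : endo) x : (a *: f) x = a *: f x. Proof. by []. Qed.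

Fact endo_scaleAl a (f g : endo) : a *: (f * g) = (a *: f) * g.
Proof. exact: endoP. Qed.
Fact endo_scaleAr a (f g : endo) : a *: (f * g) = f * (a *: g).
Proof.
by apply: endoP => x; apply/esym/(linearZ_LR (f : {linear U -> U})).
Qed.

(* The product f . g of the special Jordan algebra End(U)^+. *)
Definition endo_jmul (f g : endo) : endo := 2^-1 *: (f * g + g * f).

Fact endo_jmulC : commutative endo_jmul.
Proof. by move=> f g; rewrite /endo_jmul addrC. Qed.
Fact endo_jmul_linearr f : linear (endo_jmul f).
Proof.
move=> c g h; rewrite /endo_jmul [c *: (2^-1 *: _)]scalerA [c * _]mulrC.
rewrite -[in RHS]scalerA -scalerDr; congr (_ *: _).
by rewrite mulrDl mulrDr -endo_scaleAl -endo_scaleAr addrACA scalerDr.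
Qed.

End Endomorphisms.

Section Span.
Variables (F : fieldType) (V : lmodType F) (S : V -> Prop).

Definition span : {pred V} := [pred v | `[< exists s : seq (F * V),
  {in s, forall p, S p.2} /\ v = \sum_(p <- s) p.1 *: p.2 >]].

Lemma spanP v : reflect (exists s : seq (F * V),
  {in s, forall p, S p.2} /\ v = \sum_(p <- s) p.1 *: p.2) (v \in span).
Proof. exact: asboolP. Qed.

Lemma mem_span v : S v -> v \in span.
Proof.
move=> Sv; apply/spanP; exists [:: (1, v)]; rewrite big_seq1 scale1r.
by split=> // p; rewrite inE => /eqP->.
Qed.

Fact span_submod_closed : submod_closed span.
Proof.
split=> [|a u v /spanP[s [Ss ->]] /spanP[r [Sr ->]]]; apply/spanP.
  by exists [::]; rewrite big_nil.
exists ([seq (a * p.1, p.2) | p <- s] ++ r); split=> [p|].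
  by rewrite mem_cat => /orP[/mapP[q /Ss Sq ->]|/Sr].
rewrite big_cat big_map /= scaler_sumr; congr (_ + _).
by apply: eq_bigr => p _; rewrite scalerA.
Qed.

HB.instance Definition _ := GRing.isSubmodClosed.Build F V span
  span_submod_closed.

Record span_of : Type := SpanOf {
  span_val : V;
  span_valP : span_val \in span
}.

HB.instance Definition _ := [isSub for span_val].
HB.instance Definition _ := [Choice of span_of by <:].
HB.instance Definition _ := [SubChoice_isSubLmodule of span_of by <:].

End Span.

Section TrilinearMaps.
Variables (F : fieldType) (U : lmodType F).

Record trilinear := Trilinear {
  tri_fun :> U -> U -> U -> U;
  tri_linear1 : forall y z, linear (fun x => tri_fun x y z);
  tri_linear2 : forall x z, linear (fun y => tri_fun x y z);
  tri_linear3 : forall x y, linear (fun z => tri_fun x y z)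
}.

End TrilinearMaps.

Section FreudenthalKantor.
Variables (F : fieldType) (U : lmodType F) (t : trilinear U).
Implicit Types (x y z u v : U) (eps delta : F).

Definition FK_Lfun x y z : U := t x y z.
Fact FK_Lfun_linear x y : linear (FK_Lfun x y).
Proof. exact: tri_linear3. Qed.
HB.instance Definition _ x y :=
  GRing.isLinear.Build F U U *:%R (FK_Lfun x y) (FK_Lfun_linear x y).
Definition FK_L x y : endo U := FK_Lfun x y : {linear U -> U}.

Definition FK_Kfun delta x y z : U := t x z y - delta *: t y z x.
Fact FK_Kfun_linear delta x y : linear (FK_Kfun delta x y).
Proof.
move=> a z w; rewrite /FK_Kfun !(tri_linear2 t) scalerDr scalerBr.
by rewrite opprD addrACA !scalerA [delta * a]mulrC.
Qed.
HB.instance Definition _ delta x y :=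
  GRing.isLinear.Build F U U *:%R (FK_Kfun delta x y)
    (FK_Kfun_linear delta x y).
Definition FK_K delta x y : endo U :=
  FK_Kfun delta x y : {linear U -> U}.

Record is_FKTS eps delta : Prop := {
  FKTS_eps : eps = 1 \/ eps = -1;
  FKTS_delta : delta = 1 \/ delta = -1;
  FKTS_LL : forall x y u v,
    FK_L u v * FK_L x y - FK_L x y * FK_L u v =
      FK_L (FK_L u v x) y + eps *: FK_L x (FK_L v u y);
  FKTS_KK : forall x y u v,
    FK_K delta (FK_K delta u v x) y =
      FK_L y x * FK_K delta u v - eps *: (FK_K delta u v * FK_L x y)
}.

Definition is_special_FKTS eps delta : Prop :=
  is_FKTS eps delta /\
  forall x y, FK_K delta x y = (eps * delta) *: FK_L y x - eps *: FK_L x y.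

End FreudenthalKantor.

Section JTernary.
Variables (F : fieldType) (J T : lmodType F).
Implicit Types (a b : J) (x y z w v : T).

Record is_unital_jordan (mul : {bilinear J -> J -> J}) (e : J) : Prop := {
  jordan_mulC : commutative mul;
  jordan_identity : forall a b,
    mul (mul (mul a a) b) a = mul (mul a a) (mul b a);
  jordan_mul1 : left_id e mul
}.

Record is_special_module (mul : {bilinear J -> J -> J}) (e : J)
    (act : {bilinear J -> T -> T}) : Prop := {
  special_act1 : forall x, act e x = x;
  special_actM : forall a b x,
    act (mul a b) x = 2^-1 *: (act a (act b x) + act b (act a x))
}.

Record is_J_ternary (mul : {bilinear J -> J -> J}) (e : J)
    (act : {bilinear J -> T -> T}) (br : {bilinear T -> T -> J})
    (t : trilinear T) : Prop := {
  JT_jordan : is_unital_jordan mul e;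
  JT_module : is_special_module mul e act;
  JT_skew : forall x y, br x y = - br y x;
  JT1 : forall a x y,
    mul a (br x y) = 2^-1 *: (br (act a x) y + br x (act a y));
  JT2 : forall a x y z,
    act a (t x y z) = t (act a x) y z - t x (act a y) z + t x y (act a z);
  JT3 : forall x y z, t x y z = t z y x - act (br x z) y;
  JT4 : forall x y z, t x y z = t y x z + act (br x y) z;
  JT5 : forall x y z w,
    br (t x y z) w + br z (t x y w) = br x (act (br z w) y);
  JT6 : forall x y z w v,
    t x y (t z w v) = t (t x y z) w v + t z (t y x w) v + t z w (t x y v)
}.

End JTernary.

Section SpaceJ.
Variables (F : fieldType) (U : lmodType F) (t : trilinear U).

Definition FK_J_gen (f : endo U) : Prop :=
  f = 1 \/ exists x y, f = FK_K t 1 x y.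

(* J = F 1 + K(U, U), for delta = 1, as a vector space over F. *)
Definition FK_J : Type := span_of FK_J_gen.
HB.instance Definition _ := GRing.Lmodule.on FK_J.
HB.instance Definition _ := SubChoice.on FK_J.

Fact FK_J_one_subproof : 1 \in span FK_J_gen.
Proof. by apply: mem_span; left. Qed.
Definition FK_J_one : FK_J := SpanOf FK_J_one_subproof.

Fact FK_J_K_subproof x y : FK_K t 1 x y \in span FK_J_gen.
Proof. by apply: mem_span; right; exists x, y. Qed.
Definition FK_J_K x y : FK_J := SpanOf (FK_J_K_subproof x y).

(* J is a linear subspace containing 1 by construction. *)
Definition FK_J_subalgebra : Prop :=
  {in span FK_J_gen &, forall f g, endo_jmul f g \in span FK_J_gen}.

Definition FK_J_mul (hJ : FK_J_subalgebra) (a b : FK_J) : FK_J :=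
  @SpanOf _ _ FK_J_gen (endo_jmul (span_val a) (span_val b))
    (hJ _ _ (span_valP a) (span_valP b)).

Definition FK_J_act (a : FK_J) (x : U) : U := span_val a x.

Definition FK_J_bracket (x y : U) : FK_J := - FK_J_K x y.

Fact FK_J_mul_bilinear hJ : bilinear_for *:%R *:%R (FK_J_mul hJ).
Proof.
split=> [b c a a'|a c b b']; apply: val_inj; rewrite linearP /=.
  by rewrite ![endo_jmul _ (span_val b)]endo_jmulC endo_jmul_linearr.
exact: endo_jmul_linearr.
Qed.
HB.instance Definition _ hJ := bilinear_isBilinear.Build
  F FK_J FK_J FK_J *:%R *:%R (FK_J_mul hJ) (FK_J_mul_bilinear hJ).

Fact FK_J_act_bilinear : bilinear_for *:%R *:%R FK_J_act.
Proof.
split=> [x c a b|a c x y]; rewrite /FK_J_act.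
  have -> // : span_val (c *: a + b) = c *: span_val a + span_val b.
  exact: (linearP val).
exact: (linearP (span_val a : {linear U -> U})).
Qed.
HB.instance Definition _ := bilinear_isBilinear.Build
  F FK_J U U *:%R *:%R FK_J_act FK_J_act_bilinear.

Fact FK_J_bracket_bilinear : bilinear_for *:%R *:%R FK_J_bracket.
Proof.
split=> [y c x x'|x c y y']; rewrite /= /FK_J_bracket scalerN -opprD;
  congr (- _); apply: val_inj; rewrite linearP /=; apply: endoP => z;
  rewrite endoDE endoZE /FK_K /= /FK_Kfun
    (tri_linear1 t) (tri_linear3 t) !scale1r scalerBr opprD;
  exact: addrACA.
Qed.
HB.instance Definition _ := bilinear_isBilinear.Build
  F U U FK_J *:%R *:%R FK_J_bracket FK_J_bracket_bilinear.

End SpaceJ.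

(* Main.v *)
Require Import Defs.
From HB Require Import structures.
From mathcomp Require Import all_boot all_algebra.
Import GRing.Theory.
Local Open Scope ring_scope.

(** Write L(x,y)z = xyz and K(x,y)z = xzy - yzx.

    From a J-ternary algebra: (JT3) says that K(x,y) is the action of -<x|y>,
    (JT4) that L(y,x) - L(x,y) is as well, so the system is special, and
    (JT6) is the identity for [L(u,v),L(x,y)].  The identity for K(K(u,v)x,y)
    becomes, with a = <u|v>, the relation
      a(xyz) = yx(az) + <ax|y>z,                 (lemma J_ternary_act_L)
    which holds for every a in J.  By (JT2) and (JT4) the difference of its two
    sides is skew in x and y; by (JT4) and the fact that (JT1) makes a a
    derivation of the bracket, that difference is also symmetric in x and y.
    As 2 is invertible, it vanishes.

    Conversely, for a special system, the relation
      K(ax,y) = L(y,x)a - aL(x,y)                (lemma J_twisted_derivation)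
    is linear in a, holds for a = 1 because the system is special and for
    a = K(u,v) by the second axiom, hence for all a in J.  Everything about J
    follows from it.  Antisymmetrizing it in x and y gives
      aK(x,y) + K(x,y)a = K(ax,y) + K(x,ay),
    which is (JT1) and shows that J is closed under the Jordan product.  (JT5)
    is the special case a = K(z,w), compared with the commutator of L(x,y) and
    K(z,w) given by the first axiom.  The less evident point is (JT2): by
    speciality xyz + xzy is a symmetric function of x, y and z, and playing
    this symmetry against the relation shows that x(ay)z + x(az)y is symmetric
    as well (lemma J_middle_symmetry); this turns the relation into (JT2). *)

Set Implicit Arguments.
Unset Strict Implicit.
Unset Printing Implicit Defensive.

(** * Preliminaries *)

Lemma addr_cross (V : zmodType) (a b c d : V) :
  a + b = c + d -> a - c = d - b.
Proof. by move/(canRL (addrK _))->; rewrite addrC addrA addKr. Qed.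

Lemma subr_cross (V : zmodType) (a b c d : V) :
  a - c = d - b -> a + b = c + d.
Proof. by move/(canRL (subrK _))->; rewrite addrAC subrK addrC. Qed.

Lemma span_submod_ind (F : fieldType) (V : lmodType F) (S P : V -> Prop) :
  P 0 -> (forall c u v, P u -> P v -> P (c *: u + v)) ->
  (forall v, S v -> P v) -> forall v, v \in Defs.span S -> P v.
Proof.
move=> P0 PL PS v /spanP[s [Ss ->]]; elim: s Ss => [|p s IHs] Ss.
  by rewrite big_nil.
rewrite big_cons; apply: PL; first by apply/PS/Ss; rewrite mem_head.
by apply: IHs => q sq; apply: Ss; rewrite inE sq orbT.
Qed.

Lemma two_neq0 (F : fieldType) : 2%N \notin [pchar F] -> (2 : F) != 0.
Proof. by move=> char2; apply: contra char2 => two0; apply/andP. Qed.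

Lemma scale2_inj (F : fieldType) (V : lmodType F) (u v : V) :
  2%N \notin [pchar F] -> u + u = v + v -> u = v.
Proof.
move=> /two_neq0 two_neq0 uv; apply: (scalerI two_neq0).
by rewrite !scaler_nat !mulr2n.
Qed.

Lemma half_double (F : fieldType) (V : lmodType F) (u : V) :
  2%N \notin [pchar F] -> (2 : F)^-1 *: (u + u) = u.
Proof.
move=> /two_neq0 two_neq0.
by rewrite -mulr2n -scaler_nat scalerA mulVf ?scale1r.
Qed.

(** * The special Jordan algebra of endomorphisms *)

Lemma endo_jmul_sqr (F : fieldType) (U : lmodType F) (f : endo U) :
  2%N \notin [pchar F] -> endo_jmul f f = f * f.
Proof. exact: half_double. Qed.

(** With p = f * f, both sides are a quarter of pgf + gpf + fpg + fgp, since
    p commutes with f. *)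
Lemma endo_jmul_jordan (F : fieldType) (U : lmodType F) (f g : endo U) :
  2%N \notin [pchar F] ->
  endo_jmul (endo_jmul (endo_jmul f f) g) f
    = endo_jmul (endo_jmul f f) (endo_jmul g f).
Proof.
move=> char2; rewrite (endo_jmul_sqr f char2) /endo_jmul.
rewrite -!endo_scaleAl -!endo_scaleAr -!scalerDr; do 2![congr (_ *: _)].
rewrite !mulrDl !mulrDr !mulrA.
by rewrite addrACA.
Qed.

(** * From J-ternary algebras to Freudenthal-Kantor triple systems *)

Section JTernaryToFK.
Variables (F : fieldType) (J T : lmodType F).
Variables (mul : {bilinear J -> J -> J}) (e : J).
Variables (act : {bilinear J -> T -> T}) (br : {bilinear T -> T -> J}).
Variable t : trilinear T.
Hypothesis char2 : 2%N \notin [pchar F].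
Hypothesis tJ : is_J_ternary mul e act br t.

Lemma J_ternary_K x y z : FK_K t 1 x y z = - act (br x y) z.
Proof.
by rewrite /FK_K /= /FK_Kfun scale1r (JT3 tJ x z y) addrAC subrr add0r.
Qed.

(** This is (JT1) as seen by the action, which turns the Jordan product into
    half an anticommutator. *)
Lemma act_br_derivation (a : J) (x y z : T) :
  act (br (act a x) y) z + act (br x (act a y)) z
    = act a (act (br x y) z) + act (br x y) (act a z).
Proof.
have /invr_neq0 half_neq0 := two_neq0 char2.
apply: (scalerI half_neq0); rewrite -(special_actM (JT_module tJ)) (JT1 tJ).
by rewrite linearZl_LR linearDl.
Qed.

(** The (1,1) Freudenthal-Kantor identity for K(K(u,v)x,y), with an arbitrary
    element of J in the place of the bracket of u and v. *)
Lemma J_ternary_act_L (a : J) (x y z : T) :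
  act a (t x y z) = t y x (act a z) + act (br (act a x) y) z.
Proof.
pose u x y := act a (t x y z) - (t y x (act a z) + act (br (act a x) y) z).
(* The defect u is skew by (JT2) and symmetric by (JT1), hence zero. *)
have uE p q :
    u p q = t q (act a p) z - t p (act a q) z + act (br p q) (act a z).
  rewrite /u (JT2 tJ) (JT4 tJ (act a p)) (JT4 tJ p q (act a z)).
  rewrite [X in X - _](AC (2*1*2) ((1*3)*5*(4*2))) /=; exact: addrK.
have uN : u x y = - u y x.
  by rewrite !uE (JT_skew tJ y x) linearNl opprD opprB opprK.
have uC : u x y = u y x.
  rewrite /u (JT4 tJ x y z) linearDr (JT4 tJ x y (act a z)).
  have /(canRL (addrK _)) -> := act_br_derivation a x y z.
  rewrite (JT_skew tJ (act a y)) linearNl -addrA; congr (_ + _).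
  by rewrite [X in _ - X](AC (1*(2*1)) ((1*3*4)*2)) /= opprD addrCA subrr addr0.
apply/eqP; rewrite -subr_eq0; apply/eqP/(scale2_inj char2).
by rewrite addr0 -/(u x y) {1}uN uC addNr.
Qed.

Lemma J_ternary_special_FKTS : is_special_FKTS t 1 1.
Proof.
split; last first.
  move=> x y; apply: endoP => z; rewrite J_ternary_K mulr1 !scale1r.
  rewrite endoDE endoNE /FK_L /= /FK_Lfun (JT4 tJ x y) opprD addrA.
  by rewrite subrr add0r.
split; [by left | by left | |] => x y u v; apply: endoP => z; rewrite scale1r.
  by rewrite !endoDE endoNE !endoME /FK_L /= /FK_Lfun (JT6 tJ) addrK.
rewrite endoDE endoNE !endoME !J_ternary_K linearN /FK_L /= /FK_Lfun.
rewrite !linearNl !opprK J_ternary_act_L.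
by rewrite addKr.
Qed.

End JTernaryToFK.

(** * From special Freudenthal-Kantor triple systems to J-ternary algebras *)

Section FKToJTernary.
Variables (F : fieldType) (U : lmodType F) (t : trilinear U).
Hypothesis char2 : 2%N \notin [pchar F].
Hypothesis tFK : is_special_FKTS t 1 1.

Local Notation K := (FK_K t 1).
Local Notation L := (FK_L t).
Local Notation J := (Defs.span (FK_J_gen t)).
Implicit Types (x y z : U) (a : endo U).

Lemma FK_K_special x y : K x y = L y x - L x y.
Proof. by case: tFK => _ ->; rewrite mulr1 !scale1r. Qed.

Lemma FK_K_skew x y : K x y = - K y x.
Proof. by rewrite !FK_K_special opprB. Qed.

Lemma FK_LL x y z v w :
  t x y (t z v w) = t (t x y z) v w + t z (t y x v) w + t z v (t x y w).
Proof.
have [/FKTS_LL/(_ z v x y)/(congr1 (fun f : endo U => f w)) + _] := tFK.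
rewrite scale1r !endoDE endoNE !endoME => /(canRL (subrK _)).
exact.
Qed.

Lemma FK_K_linearl y : linear (K^~ y).
Proof.
move=> c x x'; apply: endoP => z.
rewrite endoDE endoZE /FK_K /= /FK_Kfun !scale1r.
by rewrite (tri_linear1 t) (tri_linear3 t) scalerBr opprD addrACA.
Qed.

Lemma FK_K0l y : K 0 y = 0.
Proof.
by have := zmod_morphism_linear (FK_K_linearl y) 0 0; rewrite !subrr.
Qed.

(** The two expressions of K(x,y)z, as xzy - yzx and as yxz - xyz, agree. Since
    xyz + xzy is visibly symmetric in y and z, this makes it symmetric in
    all three variables. *)
Lemma special_symmetry x y z : t x y z + t x z y = t y x z + t y z x.
Proof.
have /(congr1 (fun f : endo U => f z)) := FK_K_special x y.
rewrite endoDE endoNE /FK_K /FK_L /= /FK_Kfun /FK_Lfun scale1r.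
by move=> /subr_cross; rewrite addrC [in RHS]addrC.
Qed.

(** The second Freudenthal-Kantor axiom, spread over J by linearity; for the
    identity of U it is speciality. *)
Lemma J_twisted_derivation a x y :
  a \in J -> K (a x) y = L y x * a - a * L x y.
Proof.
move: a; apply: span_submod_ind => [|c a b Pa Pb|a [->|[u [v ->]]]].
- by rewrite mulr0 mul0r subr0 endo0E FK_K0l.
- rewrite endoDE endoZE FK_K_linearl Pa Pb mulrDr mulrDl.
  by rewrite -endo_scaleAr -endo_scaleAl scalerBr opprD addrACA.
- by rewrite endo1E mulr1 mul1r FK_K_special.
- by case: tFK => /FKTS_KK ->; rewrite scale1r.
Qed.

(** Antisymmetrization in x and y of the preceding relation, as
    K(x,y) = L(y,x) - L(x,y). *)
Lemma J_jordan_derivation a x y :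
  a \in J -> a * K x y + K x y * a = K (a x) y + K x (a y).
Proof.
move=> Ja; rewrite (FK_K_skew x (a y)) !(J_twisted_derivation _ _ Ja) opprB.
rewrite FK_K_special mulrBr mulrBl.
by rewrite [LHS](AC (2*2) ((3*2)*(1*4))).
Qed.

Lemma J_act_L a x y z :
  a \in J -> a (t x y z) = t y x (a z) + t y z (a x) - t (a x) z y.
Proof.
move=> /(J_twisted_derivation x y)/(congr1 (fun f : endo U => f z)).
rewrite endoDE endoNE !endoME /FK_K /= /FK_Kfun /FK_Lfun scale1r => eq_z.
by rewrite -addrA -opprB eq_z opprB addrC subrK.
Qed.

(** Let h(x,y,z) = xyz + xzy, the symmetric function of special_symmetry, and
    put P(x) = h(ax,y,z) and Q(x) = xy(az) + xz(ay), with P(y), Q(y), P(z) and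
    Q(z) obtained by permuting x, y and z. Summing J_act_L over the two orders
    of y and z gives
      a h(x,y,z) = Q(y) + Q(z) - P(x),
    so P + Q takes the same value at x, y and z. On the other hand the symmetry
    of h with az, or ay, among its arguments gives
      x(ay)z + x(az)y = P(z) + P(y) - Q(x),
    whose value is unchanged when x and y are swapped. *)
Lemma J_middle_symmetry a x y z : a \in J ->
  t x (a y) z + t x (a z) y = t y (a x) z + t y (a z) x.
Proof.
move=> Ja.
pose h x y z := t x y z + t x z y.
pose P x y z := h (a x) y z.
pose Q x y z := t x y (a z) + t x z (a y).
have PC p q r : P p q r = P p r q by rewrite /P /h addrC.
have QC p q r : Q p q r = Q p r q by rewrite /Q addrC.
have ah p q r : a (h p q r) = Q q p r + Q r p q - P p q r.
  rewrite /h linearD (J_act_L p q r Ja) (J_act_L p r q Ja) addrACA -opprD.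
  by rewrite [X in _ - X]addrC.
have PQ p q r : P p q r + Q p q r = P q p r + Q q p r.
  have: a (h p q r) = a (h q p r) by rewrite /h special_symmetry.
  rewrite !ah (QC r q p) ![_ + Q r p q - _]addrAC => /addIr/subr_cross.
  by move=> <-; rewrite addrC.
have middle p q r : t p (a q) r + t p (a r) q = P r p q + P q p r - Q p q r.
  apply: (canRL (addrK _)); rewrite /P /Q /h !(special_symmetry (a _) p).
  by rewrite [RHS](AC (2*2) ((3*1)*(2*4))).
rewrite !middle (PC z y x) -[LHS]addrA -[RHS]addrA; congr (_ + _).
by apply/addr_cross; rewrite -PQ addrC.
Qed.

(** (JT2) differs from J_act_L by two exchanges: one is the symmetry of
    xyz + xzy with ax in first position, the other the difference of that
    symmetry with az in last position and of J_middle_symmetry. *)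
Lemma J_alternating_derivation a x y z : a \in J ->
  a (t x y z) = t (a x) y z - t x (a y) z + t x y (a z).
Proof.
move=> Ja; have /addr_cross swap_x := special_symmetry (a x) y z.
have swap_z : t x y (a z) - t x (a y) z = t y x (a z) - t y (a x) z.
  have := congr2 (fun u v => u - v) (special_symmetry x y (a z))
    (J_middle_symmetry x y z Ja).
  by rewrite !opprD [LHS]addrACA [RHS]addrACA !subrr !addr0.
rewrite (J_act_L x y z Ja) -addrA -swap_x [RHS]addrAC -[RHS]addrA swap_z.
exact: addrCA.
Qed.

(** By the first axiom L(x,y) acts on triple products as a derivation, except
    that L(y,x) acts on the middle factor; in K(z,w)v = zvw - wvz that factor
    is v. *)
Lemma L_K_commutation x y z w :
  L x y * K z w = K (t x y z) w + K z (t x y w) + K z w * L y x.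
Proof.
apply: endoP => v; rewrite !endoDE !endoME /FK_K /FK_L /= /FK_Kfun /FK_Lfun.
rewrite !scale1r [LHS](linearB (L x y)) /= /FK_Lfun.
rewrite (FK_LL x y z v w) (FK_LL x y w v z) !opprD.
by rewrite [LHS](AC (3*3) ((1*6)*(3*4)*(2*5))).
Qed.

Lemma J_subalgebra : FK_J_subalgebra t.
Proof.
move=> f g Jf; move: g.
apply: span_submod_ind => [|c g h Jg Jh|g [->|[x [y ->]]]].
- by rewrite /endo_jmul mulr0 mul0r addr0 scaler0 rpred0.
- by rewrite endo_jmul_linearr; apply: (span_submod_closed _).2.
- by rewrite /endo_jmul mulr1 mul1r half_double.
- rewrite /endo_jmul J_jordan_derivation //.
  by apply: rpredZ; apply: rpredD; exact: FK_J_K_subproof.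
Qed.

Lemma FK_J_act_bracket x y z : FK_J_act (FK_J_bracket t x y) z = - K x y z.
Proof. by []. Qed.

Lemma special_FKTS_J_ternary :
  is_J_ternary (FK_J_mul J_subalgebra) (FK_J_one t)
    (@FK_J_act F U t) (FK_J_bracket t) t.
Proof.
split.
- split.
  + by move=> a b; apply: val_inj; apply: endo_jmulC.
  + by move=> a b; apply: val_inj; apply: endo_jmul_jordan.
  + by move=> a; apply: val_inj; rewrite /= /endo_jmul mulr1 mul1r half_double.
- by split.
- by move=> x y; apply: val_inj => /=; rewrite /= FK_K_skew.
- move=> a x y; apply: val_inj => /=.
  rewrite /endo_jmul mulrN mulNr -!opprD; congr (_ *: - _).
  exact: J_jordan_derivation (span_valP a).
- by move=> a x y z; apply: J_alternating_derivation (span_valP a).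
- move=> x y z /=; rewrite FK_J_act_bracket opprK.
  by rewrite /FK_K /= /FK_Kfun scale1r addrC subrK.
- move=> x y z /=; rewrite FK_J_act_bracket FK_K_special endoDE endoNE.
  by rewrite opprB /FK_L /= /FK_Lfun addrC subrK.
- move=> x y z w; apply: val_inj => /=.
  (* J_twisted_derivation applies to the element <z|w> of J, which sits in the
     first argument of K once K is reversed. *)
  rewrite [K x _]FK_K_skew opprK -opprD.
  rewrite (J_twisted_derivation _ _ (span_valP _)) /= mulrN mulNr.
  by rewrite L_K_commutation -opprD addrK.
- exact: FK_LL.
Qed.

End FKToJTernary.

Theorem theorem3p7 (F : fieldType)
    (char2 : 2%N \notin [pchar F]) (char3 : 3%N \notin [pchar F]) :
  (forall (J T : lmodType F) (mul : {bilinear J -> J -> J}) (e : J)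
      (act : {bilinear J -> T -> T}) (br : {bilinear T -> T -> J})
      (t : trilinear T),
    is_J_ternary mul e act br t -> is_special_FKTS t 1 1)
  /\
  (forall (U : lmodType F) (t : trilinear U),
    is_special_FKTS t 1 1 ->
    exists hJ : FK_J_subalgebra t,
      is_J_ternary (FK_J_mul hJ) (FK_J_one t)
        (@FK_J_act F U t) (FK_J_bracket t) t).
Proof.
split=> [J T mul e act br t tJ|U t tFK].
  exact: J_ternary_special_FKTS char2 tJ.
by exists (J_subalgebra char2 tFK); apply: special_FKTS_J_ternary.
Qed.
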